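(* There exists a constant $K$ such that for every integer $n\geq 3$, $\delta(D_n)\leq\frac{31}{16}n+K$.
   Context: Polygons are treated combinatorially: a convex polygon is a finite set of vertices with a clockwise cyclic order; edges are $2$-element vertex sets, two edges cross if disjoint with alternating vertices in the cyclic order; a triangulation is an inclusion-maximal set of pairwise non-crossing edges; a flip replaces an interior edge $\varepsilon$ of $T$ by the other diagonal of the unique quadrilateral with diagonal $\varepsilon$ and sides in $T$. For a pair $P=\{U,V\}$, $\delta(P)$ is the minimum number of flips transforming $U$ into $V$. Deletion: for a vertex $a$ of a polygon with at least $4$ vertices, with clockwise successor $b$, $T\ominus a=\{\varepsilon \text{ with } a \text{ replaced by } b:\varepsilon\in T\setminus\{\{a,b\}\}\}$, a triangulation of the polygon with $a$ removed. Zigzag: for $N\geq 4$, on the polygon with vertices $0,\dots,N-1$ labeled clockwise (mod $N$), $Z_N$ is the triangulation whose interior edges are $\varepsilon_{2k+1}=\{2-k,4+k\}$ and $\varepsilon_{2k+2}=\{1-k,4+k\}$ ($k\geq0$), for indices $1,\dots,N-3$. Pair $D_n$ ($n\geq3$): $D_n^-$ is $Z_{n+2}$ with vertices $0$ then $1$ deleted, its vertices relabeled clockwise $0,\dots,n-1$ so that the former vertex $2$ gets label $n-1$; $D_n^+$ is $Z_{n+1}$ with vertex $4$ deleted, its vertices relabeled clockwise $0,\dots,n-1$ so that the former vertex $2$ gets label $n-2$. Both are triangulations of the polygon with vertices $0,\dots,n-1$; $D_n=\{D_n^-,D_n^+\}$. *)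

(* Defs.v *)
From mathcomp Require Import all_boot all_order all_algebra.
From mathcomp Require Import finmap.

Set Implicit Arguments.
Unset Strict Implicit.
Unset Printing Implicit Defensive.

Local Open Scope fset_scope.

(* A convex polygon is a duplicate-free sequence p listing its vertices
   clockwise; only its cyclic order matters. The clockwise successor of a
   vertex x is [next p x]. *)

Definition is_edge (T : choiceType) (p : seq T) (e : {fset T}) : bool :=
  (#|` e| == 2) && (e `<=` [fset x in p]).

(* a, b, c are distinct and met in this order going clockwise around p. *)
Definition clockwise (T : choiceType) (p : seq T) (a b c : T) : bool :=
  let i := index a p in let j := index b p in let k := index c p in
  [|| (i < j) && (j < k), (j < k) && (k < i) | (k < i) && (i < j)].

(* The two clockwise conditions say that a, b, c, d are met in this order, so
   e and f are disjoint and their vertices alternate. *)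
Definition crossing (T : choiceType) (p : seq T) (e f : {fset T}) : Prop :=
  exists a b c d : T,
    [/\ e = [fset a; c], f = [fset b; d], clockwise p a b c & clockwise p c d a].

Definition noncrossing (T : choiceType) (p : seq T) (S : {fset {fset T}}) : Prop :=
  (forall e, e \in S -> is_edge p e) /\
  (forall e f, e \in S -> f \in S -> ~ crossing p e f).

Definition triangulation (T : choiceType) (p : seq T) (S : {fset {fset T}}) : Prop :=
  noncrossing p S /\
  (forall S' : {fset {fset T}}, noncrossing p S' -> S `<=` S' -> S' = S).

Definition boundary (T : choiceType) (p : seq T) : {fset {fset T}} :=
  [fset [fset x; next p x] | x in p].

Definition flip (T : choiceType) (p : seq T) (S S' : {fset {fset T}}) : Prop :=
  triangulation p S /\
  exists a b c d : T,
    [/\ clockwise p a b c /\ clockwise p c d a,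
        [fset a; c] \in S /\ [fset a; c] \notin boundary p,
        [/\ [fset a; b] \in S, [fset b; c] \in S,
            [fset c; d] \in S & [fset d; a] \in S]
      & S' = [fset b; d] |` (S `\ [fset a; c])].

Fixpoint flips (T : choiceType) (p : seq T) (k : nat) (U V : {fset {fset T}}) : Prop :=
  if k is k'.+1 then exists W, flip p U W /\ flips p k' W V else U = V.

(* d is the value of delta on the pair P of triangulations of p. *)
Definition is_delta (T : choiceType) (p : seq T)
    (P : {fset {fset T}} * {fset {fset T}}) (d : nat) : Prop :=
  flips p d P.1 P.2 /\ (forall k, flips p k P.1 P.2 -> d <= k).

(* The result lives on the polygon [rem a p]. *)
Definition deletion (T : choiceType) (p : seq T) (a : T) (S : {fset {fset T}}) :
    {fset {fset T}} :=
  let b := next p a in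
  [fset [fset (if x == a then b else x) | x in (e : {fset T})]
     | e in S `\ [fset a; b]].

(* The clockwise labelling of p by 0, ..., size p - 1 giving label c to v. *)
Definition label (T : choiceType) (p : seq T) (v : T) (c : nat) (x : T) : nat :=
  (c + (size p - index v p) + index x p) %% size p.

Definition relabel (T : choiceType) (p : seq T) (v : T) (c : nat)
    (S : {fset {fset T}}) : {fset {fset nat}} :=
  [fset [fset label p v c x | x in (e : {fset T})] | e in S].

Definition polygon (N : nat) : seq nat := iota 0 N.

(* The interior edge of index i, where i = 2k+1 or i = 2k+2. N is added before
   subtracting k to avoid truncation (k <= N for the indices in use). *)
Definition zigzag_edge (N i : nat) : {fset nat} :=
  let k := i.-1./2 in
  if odd i then [fset (N + 2 - k) %% N; (4 + k) %% N]
  else [fset (N + 1 - k) %% N; (4 + k) %% N].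

Definition zigzag (N : nat) : {fset {fset nat}} :=
  boundary (polygon N) `|` [fset zigzag_edge N i | i in iota 1 (N - 3)].

Definition Dminus (n : nat) : {fset {fset nat}} :=
  let p0 := polygon (n + 2) in
  let p1 := rem 0 p0 in
  let p2 := rem 1 p1 in
  relabel p2 2 (n - 1) (deletion p1 1 (deletion p0 0 (zigzag (n + 2)))).

(* Vertices are read modulo n + 1: vertex 4 is vertex 0 when n = 3. *)
Definition Dplus (n : nat) : {fset {fset nat}} :=
  let p0 := polygon (n + 1) in
  let a := 4 %% (n + 1) in
  relabel (rem a p0) 2 (n - 2) (deletion p0 a (zigzag (n + 1))).

Definition D (n : nat) : {fset {fset nat}} * {fset {fset nat}} :=
  (Dminus n, Dplus n).

(* Main.v *)
Require Import Defs.
From mathcomp Require Import all_boot all_order all_algebra.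
From mathcomp Require Import finmap zify lra.
From Stdlib Require Import Classical_Prop.

(** Write [L_i] for vertex [i] and [R_k] for vertex [n - k]. Up to a bounded number
    of edges, [D_n^-] consists of the edges [L_(k+1) R_k] and [L_(k+2) R_k], and
    [D_n^+] of the edges [L_(k-4) R_k] and [L_(k-3) R_k]: two zigzags that differ by
    a shift. A front sweeps along the polygon: behind it the triangulation agrees
    with [D_n^+], ahead of it with [D_n^-], and between the edges [L_1 R_5] and
    [L_9 R_8] (shifted by the position of the front) there is a fixed triangulation
    of a 13-gon. Advancing the front by 8 consumes 16 vertices and can be done with
    31 flips, one less than two per edge. The two ends of the sweep involve
    polygons of bounded size, where one passes through a fan. *)

Set Implicit Arguments.
Unset Strict Implicit.
Unset Printing Implicit Defensive.

Local Open Scope fset_scope.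
Local Open Scope nat_scope.

(** * Triangulations of [polygon n] as relations *)

Definition pairs (n : nat) : seq (nat * nat) :=
  [seq q <- [seq (x, y) | x <- iota 0 n, y <- iota 0 n] | q.1 < q.2].

Lemma mem_pairs n x y : ((x, y) \in pairs n) = (x < y) && (y < n).
Proof.
rewrite mem_filter /=; case: ltnP => //= xy.
apply/allpairsP/idP => [[[u v] /= [_ hv [_ ->]]]|yn].
  by rewrite mem_iota in hv.
by exists (x, y); rewrite !mem_iota; split => //=; lia.
Qed.

(** An edge is represented by its increasing pair, so only the values of [P] at [x < y < n] count
    and relations can be given by linear arithmetic. *)
Definition edges_of (n : nat) (P : rel nat) : {fset {fset nat}} :=
  [fset [fset q.1; q.2] | q in [seq q <- pairs n | P q.1 q.2]].

Lemma in_edges_of n P (e : {fset nat}) :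
  e \in edges_of n P <->
  exists x y, [/\ x < y, y < n, P x y & e = [fset x; y]].
Proof.
split=> [/imfsetP[[x y] /=]|[x [y [xy yn Pxy ->]]]].
  rewrite mem_filter mem_pairs /= => /and3P[Pxy xy yn] ->.
  by exists x, y.
by apply/imfsetP; exists (x, y) => //=; rewrite mem_filter mem_pairs /= Pxy xy.
Qed.

Lemma eq_fset2 (T : choiceType) (a b x y : T) :
  [fset a; b] = [fset x; y] -> (a = x /\ b = y) \/ (a = y /\ b = x).
Proof.
move=> /fsetP E; have := E a; have := E b; have := E x; have := E y.
rewrite !in_fset2 !eqxx ?orbT /= => Ey Ex Eb Ea.
move/esym/orP: Ea => [] /eqP Ea; move/esym/orP: Eb => [] /eqP Eb; subst; auto.
- by move/orP: Ey => [] /eqP ->; auto.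
- by move/orP: Ex => [] /eqP ->; auto.
Qed.

Lemma fset2_ordered (x y u v : nat) :
  x < y -> u < v -> [fset x; y] = [fset u; v] -> x = u /\ y = v.
Proof. by move=> xy uv /eq_fset2; lia. Qed.

Lemma fset2_in_edges_of n P x y :
  x < y -> y < n -> ([fset x; y] \in edges_of n P) = P x y.
Proof.
move=> xy yn; apply/idP/idP => [/in_edges_of[u [v [uv vn Puv /fset2_ordered]]]|Pxy].
  by move=> /(_ xy uv) [-> ->].
by apply/in_edges_of; exists x, y.
Qed.

Lemma eq_edges_of n (P Q : rel nat) :
  (forall x y, x < y -> y < n -> P x y = Q x y) -> edges_of n P = edges_of n Q.
Proof.
move=> PQ; apply/fsetP => e; apply/idP/idP => /in_edges_of[x [y [xy yn h ->]]];
  by rewrite fset2_in_edges_of // ?PQ // -?PQ.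
Qed.

Definition cross (x y u v : nat) : bool :=
  [&& x < u, u < y & y < v] || [&& u < x, x < v & v < y].

Lemma index_polygon n x : x < n -> index x (polygon n) = x.
Proof.
move=> xn; rewrite /polygon.
by rewrite -{1}[x]add0n -(nth_iota 0 0 xn) index_uniq ?size_iota ?iota_uniq.
Qed.

Lemma crossing_polygon n x y u v :
  x < y -> y < n -> u < v -> v < n ->
  crossing (polygon n) [fset x; y] [fset u; v] <-> cross x y u v.
Proof.
move=> xy yn uv vn; rewrite /crossing /clockwise /cross.
have xn := ltn_trans xy yn; have un := ltn_trans uv vn.
split=> [[a [b [c [d [Eac Ebd]]]]]|].
  by case: (eq_fset2 Eac) => [] [<- <-]; case: (eq_fset2 Ebd) => [] [<- <-];
     rewrite !index_polygon //; lia.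
case/orP => h.
- by exists x, u, y, v; rewrite !index_polygon //; split=> //; lia.
- exists x, v, y, u; rewrite !index_polygon //; split=> //; try lia.
  by rewrite fsetUC.
Qed.

(** Maximality is stated edge by edge instead of over supersets: this form can be tested by
    arithmetic and transported along an exchange of diagonals. *)
Definition max_noncrossing (n : nat) (P : rel nat) : Prop :=
  (forall x y u v, x < y -> y < n -> u < v -> v < n ->
     P x y -> P u v -> ~~ cross x y u v) /\
  (forall x y, x < y -> y < n ->
     (forall u v, u < v -> v < n -> P u v -> ~~ cross x y u v) -> P x y).

Lemma cardfs2_ex (T : choiceType) (A : {fset T}) :
  #|` A| == 2 -> exists x y, x != y /\ A = [fset x; y].
Proof.
move=> A2; have /fset0Pn[x xA] : A != fset0 by rewrite -cardfs_gt0 (eqP A2).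
have /cardfs1P[y Ey] : #|` A `\ x| == 1 by move: A2; rewrite (cardfsD1 x) xA.
exists x, y; split; last by rewrite -(fsetD1K xA) Ey.
have : y \in A `\ x by rewrite Ey inE.
by rewrite !inE eq_sym => /andP[].
Qed.

Lemma is_edge_polygon n (e : {fset nat}) :
  is_edge (polygon n) e -> exists x y, [/\ x < y, y < n & e = [fset x; y]].
Proof.
case/andP => /cardfs2_ex[x [y [xy ->]]] /fsubsetP sub.
have xn : x < n by have := sub x; rewrite !inE eqxx mem_iota => /(_ isT).
have yn : y < n by have := sub y; rewrite !inE eqxx orbT mem_iota => /(_ isT).
case: (ltnP x y) => h; first by exists x, y.
by exists y, x; split => //; [lia|rewrite fsetUC].
Qed.

Lemma is_edge_fset2 n x y : x < y -> y < n -> is_edge (polygon n) [fset x; y].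
Proof.
move=> xy yn; rewrite /is_edge cardfs2 (ltn_eqF xy) /=.
by apply/fsubsetP => z; rewrite !inE mem_iota => /orP[] /eqP ->; lia.
Qed.

(** An edge of a non-crossing superset crosses no edge of [P], hence already belongs to [P]. *)
Lemma triangulation_edges_of n P :
  max_noncrossing n P -> triangulation (polygon n) (edges_of n P).
Proof.
move=> [nc mx]; split; first split.
- by move=> e /in_edges_of[x [y [xy yn _ ->]]]; apply: is_edge_fset2.
- move=> e f /in_edges_of[x [y [xy yn Pxy ->]]] /in_edges_of[u [v [uv vn Puv ->]]].
  by move=> /crossing_polygon h; have := nc _ _ _ _ xy yn uv vn Pxy Puv; rewrite h.
move=> S [Sedge Snc] /fsubsetP sub; apply/fsetP => e; apply/idP/idP; last exact: sub.
move=> eS; have [x [y [xy yn Ee]]] := is_edge_polygon (Sedge _ eS); rewrite Ee in eS *.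
rewrite fset2_in_edges_of //; apply: mx => // u v uv vn Puv; apply/negP => cr.
by apply: (Snc _ _ eS (sub [fset u; v] _)); rewrite ?fset2_in_edges_of // crossing_polygon.
Qed.

Definition exchange (P : rel nat) (e f : nat * nat) : rel nat :=
  fun x y => ((x, y) == f) || ((x, y) != e) && P x y.

Lemma edges_of_exchange n P a c b d :
  a < c -> c < n -> b < d -> d < n -> 
  edges_of n (exchange P (a, c) (b, d)) =
  [fset b; d] |` (edges_of n P `\ [fset a; c]).
Proof.
move=> ac cn bd dn; apply/fsetP => e; rewrite !inE; apply/idP/idP.
  case/in_edges_of => x [y [xy yn h ->]]; move: h; rewrite fset2_in_edges_of //.
  case/orP => [/eqP[-> ->]|/andP[ne ->]]; first by rewrite eqxx.
  rewrite andbT; apply/orP; right; apply: contra ne => /eqP /fset2_ordered[] // -> ->.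
  by rewrite eqxx.
case/orP => [/eqP ->|/andP[ne /in_edges_of[x [y [xy yn Pxy E]]]]].
  by rewrite fset2_in_edges_of // /exchange eqxx.
rewrite {}E in ne *; rewrite fset2_in_edges_of // /exchange Pxy andbT orbC.
by apply/orP; left; apply: contra ne => /eqP [-> ->].
Qed.

Lemma next_polygon n x : x < n -> next (polygon n) x = if x.+1 < n then x.+1 else 0.
Proof.
move=> xn; rewrite next_nth mem_iota add0n xn index_polygon //.
case: n xn => // n xn; rewrite /polygon [iota _ _]/=.
case: ltnP => h; first by rewrite nth_iota //; lia.
by rewrite nth_default // size_iota; lia.
Qed.

Lemma boundary_polygon n : 1 < n -> boundary (polygon n) =
  edges_of n (fun x y => (y == x.+1) || (x == 0) && (y == n.-1)).
Proof.
move=> n1; apply/fsetP => e; apply/imfsetP/idP => [[x /=]|].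
  rewrite mem_iota add0n /= => xn ->; rewrite next_polygon //.
  case: ltnP => h; first by rewrite fset2_in_edges_of // eqxx.
  rewrite fsetUC fset2_in_edges_of //; lia.
case/in_edges_of => x [y [xy yn h ->]]; case/orP: h => [/eqP Ey|/andP[/eqP x0 /eqP Ey]].
  by exists x => /=; rewrite ?mem_iota ?next_polygon -?Ey ?yn //; lia.
exists y => /=; first by rewrite mem_iota; lia.
by rewrite next_polygon // x0; case: ltnP => [|_]; [lia|rewrite fsetUC].
Qed.

(* [e] and [f] are the diagonals of a quadrilateral with sides [s]. *)
Lemma max_noncrossing_exchange n (P : rel nat) (e f : nat * nat) (s : seq (nat * nat)) :
  e \in pairs n -> f \in pairs n -> {subset s <= pairs n} ->
  cross e.1 e.2 f.1 f.2 -> P e.1 e.2 ->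
  (forall q, q \in s -> P q.1 q.2 /\ q != e) ->
  (forall x y, x < y -> cross x y e.1 e.2 ->
     (forall q, q \in s -> ~~ cross x y q.1 q.2) -> (x, y) = f) ->
  (forall x y, x < y -> cross x y f.1 f.2 ->
     (forall q, q \in s -> ~~ cross x y q.1 q.2) -> (x, y) = e) ->
  max_noncrossing n P -> max_noncrossing n (exchange P e f).
Proof.
case: e f => [e1 e2] [f1 f2] /=; rewrite !mem_pairs => /andP[e12 e2n] /andP[f12 f2n].
move=> sn ef Pe Ps He Hf [nc mx].
have crC x y u v : cross x y u v = cross u v x y by rewrite /cross; lia.
(* The sides lie in [P], so an edge of [P] crosses none of them; by [Hf] the only such edge that can
   cross [f] is [e]. *)
have ncf x y : x < y -> y < n -> P x y -> (x, y) != (e1, e2) -> ~~ cross x y f1 f2.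
  move=> xy yn Pxy ne; apply: contra ne => cr; apply/eqP/Hf => // -[u v] /[dup] uvs /Ps /= [Puv _].
  by have := sn _ uvs; rewrite mem_pairs => /andP[uv vn]; apply: nc.
split.
  move=> x y u v xy yn uv vn; rewrite /exchange.
  case: eqP => [[-> ->] _|_ /=].
    case: eqP => [[-> ->] _|_ /= /andP[ne Puv]]; first by rewrite /cross; lia.
    by rewrite crC ncf.
  case/andP => ne Pxy; case: eqP => [[-> ->] _|_ /= /andP[ne' Puv]]; first exact: ncf.
  exact: nc.
move=> x y xy yn H; rewrite /exchange.
have cf : ~~ cross x y f1 f2 by apply: H => //; rewrite /exchange eqxx.
have xe : (x, y) != (e1, e2) by apply: contra cf => /eqP[-> ->].
have cs q : q \in s -> ~~ cross x y q.1 q.2.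
  case: q => u v /[dup] uvs /Ps /= [Puv ne]; have := sn _ uvs; rewrite mem_pairs => /andP[uv vn].
  by apply: H => //; rewrite /exchange ne Puv orbT.
(* A pair that crosses [e] but no side must be [f]; a pair that does not cross [e] crosses nothing
   in [P], and maximality of [P] applies. *)
case: (boolP (cross x y e1 e2)) => ce; first by rewrite (He x y) // eqxx.
rewrite xe mx ?orbT // => u v uv vn Puv.
have [[-> ->] //|/eqP ne] := (u, v) =P (e1, e2).
by apply: H => //; rewrite /exchange ne Puv orbT.
Qed.

(** With increasing corners the diagonals are always [ac] and [bd]. Both directions of the exchange
    come from one quadrilateral, the second being read from corner [b]. *)
Lemma flip_edges_of n (P : rel nat) a b c d :
  a < b -> b < c -> c < d -> d < n ->
  P a b -> P b c -> P c d -> P a d -> max_noncrossing n P ->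
  (P a c -> flip (polygon n) (edges_of n P) (edges_of n (exchange P (a, c) (b, d))) /\
     max_noncrossing n (exchange P (a, c) (b, d))) /\
  (P b d -> flip (polygon n) (edges_of n P) (edges_of n (exchange P (b, d) (a, c))) /\
     max_noncrossing n (exchange P (b, d) (a, c))).
Proof.
move=> ab bc cd dn Pab Pbc Pcd Pad mnc; have tri := triangulation_edges_of mnc.
pose s := [:: (a, b); (b, c); (c, d); (a, d)].
have sP q : q \in s -> P q.1 q.2.
  by rewrite !inE => /or4P[] /eqP ->.
have sn : {subset s <= pairs n}.
  by move=> q; rewrite !inE => /or4P[] /eqP ->; rewrite mem_pairs; lia.
have sq x y : (forall q, q \in s -> ~~ cross x y q.1 q.2) ->
    [/\ ~~ cross x y a b, ~~ cross x y b c, ~~ cross x y c d & ~~ cross x y a d].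
  by move=> h; split; [apply: (h (a, b))|apply: (h (b, c))|apply: (h (c, d))|apply: (h (a, d))];
     rewrite !inE eqxx ?orbT.
have side x y : x < y -> y < n -> P x y -> [fset x; y] \in edges_of n P.
  by move=> xy yn; rewrite fset2_in_edges_of.
have inner x y : x < y -> y < n -> (x.+1 < y) && ((0 < x) || (y.+1 < n)) ->
    [fset x; y] \notin boundary (polygon n).
  by move=> xy yn h; rewrite boundary_polygon ?fset2_in_edges_of; lia.
have ex (e f : nat * nat) : e = (a, c) /\ f = (b, d) \/ e = (b, d) /\ f = (a, c) ->
    P e.1 e.2 -> max_noncrossing n (exchange P e f).
  move=> ef Pe; apply: (max_noncrossing_exchange (s := s)) => //.
  - by case: ef => -[-> _]; rewrite mem_pairs; lia.
  - by case: ef => -[_ ->]; rewrite mem_pairs; lia.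
  - by rewrite /cross; case: ef => -[-> ->] /=; lia.
  - move=> q qs; split; [exact: sP|move: qs].
    by case: ef => -[-> _]; rewrite !inE => /or4P[] /eqP ->; rewrite xpair_eqE; lia.
  - move=> x y xy + /sq[]; rewrite /cross.
    by case: ef => -[-> ->] /= *; congr (_, _); lia.
  - move=> x y xy + /sq[]; rewrite /cross.
    by case: ef => -[-> ->] /= *; congr (_, _); lia.
have [an bn cn] : [/\ a < n, b < n & c < n] by split; lia.
have [ac bd ad] : [/\ a < c, b < d & a < d] by split; lia.
split=> Pd; (split; last by apply: ex; auto); split=> //.
- exists a, b, c, d; rewrite /clockwise !index_polygon // edges_of_exchange //.
  split=> //; [lia|by split; [exact: side|apply: inner => //; lia]|].
  by split; rewrite 1?[ [fset d; a]]fsetUC; apply: side.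
- exists b, c, d, a; rewrite /clockwise !index_polygon // edges_of_exchange //.
  split=> //; [lia|by split; [exact: side|apply: inner => //; lia]| |].
    by split; rewrite 1?[ [fset d; a]]fsetUC; apply: side.
  by rewrite [ [fset c; a]]fsetUC.
Qed.

Lemma flips_cat (T : choiceType) (p : seq T) k l U V W :
  flips p k U V -> flips p l V W -> flips p (k + l) U W.
Proof.
elim: k U => [|k IH] U /=; first by move=> ->.
by move=> [X [UX XV]] VW; exists X; split=> //; apply: IH.
Qed.

(** * Replaying flips of a small polygon inside a large one *)

(* The quadruple [a < b < c < d] stands for exchanging the diagonals [ac] and [bd],
   whichever is present; the same quadruple thus undoes the flip. *)
Definition flip_list (m : nat) (l : seq (nat * nat)) (q : nat * nat * nat * nat) :=
  let: (a, b, c, d) := q in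
  if [&& a < b, b < c, c < d & d < m] &&
     [&& (a, b) \in l, (b, c) \in l, (c, d) \in l & (a, d) \in l] then
    if (a, c) \in l then Some ((b, d) :: filter (predC1 (a, c)) l)
    else if (b, d) \in l then Some ((a, c) :: filter (predC1 (b, d)) l)
    else None
  else None.

Fixpoint run_flips (m : nat) (l : seq (nat * nat)) (qs : seq (nat * nat * nat * nat)) :=
  if qs is q :: qs' then
    if flip_list m l q is Some l' then run_flips m l' qs' else None
  else Some l.

(** A flip depends only on its four corners, and [phi] preserves their order. The list [l] is a
    table of [P] on the image of [phi], while maximality is carried by the large triangulation;
    edges not contained in the image never change. *)
Lemma run_flips_embed n m (phi : nat -> nat) qs (P : rel nat) l l' :
  (forall i k, i < k -> k < m -> phi i < phi k) ->
  (forall i, i < m -> phi i < n) ->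
  (forall i k, i < k -> k < m -> P (phi i) (phi k) = ((i, k) \in l)) ->
  max_noncrossing n P -> run_flips m l qs = Some l' ->
  exists Q : rel nat,
    [/\ flips (polygon n) (size qs) (edges_of n P) (edges_of n Q),
        max_noncrossing n Q,
        (forall i k, i < k -> k < m -> Q (phi i) (phi k) = ((i, k) \in l')) &
        (forall x y, (forall i k, i < k -> k < m -> (x, y) <> (phi i, phi k)) ->
           Q x y = P x y)].
Proof.
move=> phiS phin.
have phiI i k : i < m -> k < m -> phi i = phi k -> i = k.
  move=> im km E; case: (ltngtP i k) => // h; [have := phiS _ _ h km|have := phiS _ _ h im]; lia.
have pexch R r e1 e2 f1 f2 : e1 < e2 -> e2 < m -> f1 < f2 -> f2 < m ->
    (forall i k, i < k -> k < m -> R (phi i) (phi k) = ((i, k) \in r)) ->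
    let R' := exchange R (phi e1, phi e2) (phi f1, phi f2) in
    (forall i k, i < k -> k < m ->
       R' (phi i) (phi k) = ((i, k) \in (f1, f2) :: filter (predC1 (e1, e2)) r)) /\
    (forall x y, (forall i k, i < k -> k < m -> (x, y) <> (phi i, phi k)) ->
       R' x y = R x y).
  move=> e12 e2m f12 f2m Rr; split=> [i k ik km|x y xy]; rewrite /exchange.
    have peq g1 g2 : g1 < g2 -> g2 < m ->
        ((phi i, phi k) == (phi g1, phi g2)) = ((i, k) == (g1, g2)).
      move=> g12 g2m; rewrite !xpair_eqE.
      by congr (_ && _); apply/eqP/eqP => [/phiI|->] // ->; lia.
    by rewrite inE mem_filter /= !peq // Rr.
  case: eqP => [E|_]; first by case: (xy _ _ f12 f2m E).
  by case: eqP => [E|//]; case: (xy _ _ e12 e2m E).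
elim: qs P l => [|[[[a b] c] d] qs IH] P l Pl mnc /=.
  by case=> <-; exists P; split.
rewrite /flip_list; case: ifP => // /andP[/and4P[ab bc cd dm] /and4P[lab lbc lcd lad]].
have [cm bm] : c < m /\ b < m by split; lia.
have [ac bd ad] : [/\ a < c, b < d & a < d] by split; lia.
have [] := @flip_edges_of n P (phi a) (phi b) (phi c) (phi d); rewrite ?Pl ?phiS ?phin //.
move=> Fac Fbd.
have step e1 e2 f1 f2 : e1 < e2 -> e2 < m -> f1 < f2 -> f2 < m ->
    flip (polygon n) (edges_of n P)
      (edges_of n (exchange P (phi e1, phi e2) (phi f1, phi f2))) /\
    max_noncrossing n (exchange P (phi e1, phi e2) (phi f1, phi f2)) ->
    run_flips m ((f1, f2) :: filter (predC1 (e1, e2)) l) qs = Some l' ->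
    exists Q : rel nat, [/\ exists W, flip (polygon n) (edges_of n P) W /\
            flips (polygon n) (size qs) W (edges_of n Q),
        max_noncrossing n Q,
        (forall i k, i < k -> k < m -> Q (phi i) (phi k) = ((i, k) \in l')) &
        (forall x y, (forall i k, i < k -> k < m -> (x, y) <> (phi i, phi k)) ->
           Q x y = P x y)].
  move=> e12 e2m f12 f2m [Fl mnc'] run.
  have [Hl Ho] := pexch P l e1 e2 f1 f2 e12 e2m f12 f2m Pl.
  have [Q [FQ mncQ QL Qo]] := IH _ _ Hl mnc' run.
  exists Q; split=> //; first by eexists; split; [exact: Fl|exact: FQ].
  by move=> x y xy; rewrite Qo // Ho.
case: ifP => [lac|_]; first by apply: step => //; apply: Fac.
by case: ifP => [lbd|//]; apply: step => //; apply: Fbd.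
Qed.

(* The window consists of the blocks [s, s + a) and [t, t + b). *)
Definition window (s a t i : nat) : nat := if i < a then s + i else t + (i - a).

(** A boolean test, so that a whole flip sequence can be certified by evaluation. Comparing
    memberships pair by pair makes the order of the final list irrelevant. *)
Definition check_flips (m : nat) (p q : rel nat) (qs : seq (nat * nat * nat * nat)) : bool :=
  if run_flips m [seq e <- pairs m | p e.1 e.2] qs is Some l
  then all (fun e => (e \in l) == q e.1 e.2) (pairs m) else false.

Lemma flips_window n s a t b (P Q p q : rel nat) qs :
  s + a <= t -> t + b <= n ->
  (forall x y, x < y -> y < n ->
     ~~ (((s <= x < s + a) || (t <= x < t + b)) && ((s <= y < s + a) || (t <= y < t + b))) ->
     P x y = Q x y) ->
  (forall i k, i < k -> k < a + b -> P (window s a t i) (window s a t k) = p i k) ->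
  (forall i k, i < k -> k < a + b -> Q (window s a t i) (window s a t k) = q i k) ->
  check_flips (a + b) p q qs -> max_noncrossing n P ->
  flips (polygon n) (size qs) (edges_of n P) (edges_of n Q) /\ max_noncrossing n Q.
Proof.
move=> sat tbn PQ Pp Qq; rewrite /check_flips.
case E: run_flips => [l|//] /allP lq mnc.
have [] := run_flips_embed (n := n) (phi := window s a t) _ _ _ mnc E.
- by move=> i k ik km; rewrite /window; case: ifP => ?; case: ifP => ?; lia.
- by move=> i im; rewrite /window; case: ifP => ?; lia.
- by move=> i k ik km; rewrite Pp // mem_filter mem_pairs ik km !andbT.
move=> R [FR mncR Rl Ro].
have RQ x y : x < y -> y < n -> R x y = Q x y.
  move=> xy yn.
  case: (boolP (((s <= x < s + a) || (t <= x < t + b)) &&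
                ((s <= y < s + a) || (t <= y < t + b)))) => [inw|out].
    (* [inv] inverts [window] on its two blocks, which reduces pairs inside the window to the
       computed table. *)
    pose inv z := if z < t then z - s else z - t + a.
    have invK z : (s <= z < s + a) || (t <= z < t + b) -> window s a t (inv z) = z.
      by rewrite /window /inv; case: (ltnP z t) => h; case: ifP; lia.
    case/andP: inw => xw yw; rewrite -(invK x) // -(invK y) //.
    have ik : inv x < inv y by move: xw yw; rewrite /inv; case: ifP; case: ifP; lia.
    have km : inv y < a + b by move: yw; rewrite /inv; case: ifP; lia.
    rewrite Rl // Qq //; apply/eqP; apply: (lq (inv x, inv y)).
    by rewrite mem_pairs ik.
  rewrite Ro ?PQ // => i k ik km [Ex Ey]; move: out; rewrite {}Ex {}Ey /window.
  by do 2 case: ifP; lia.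
split; first by rewrite -(eq_edges_of RQ).
case: mncR => nc mx; split=> [x y u v xy yn uv vn|x y xy yn H].
  by rewrite -!RQ //; apply: nc.
by rewrite -RQ //; apply: mx => // u v uv vn; rewrite RQ //; apply: H.
Qed.

(* Flips towards the fan at vertex [0]: each quadruple [(0, a, b, c)] trades [ac] for [0b]. *)
Fixpoint fan_flips (fuel : nat) (m : nat) (l : seq (nat * nat)) :=
  let apex a c := [seq b <- iota a.+1 (c - a.+1) | ((a, b) \in l) && ((b, c) \in l)] in
  let cands := flatten [seq [seq (0, e.1, b, e.2) | b <- apex e.1 e.2]
     | e <- l & [&& 0 < e.1, (0, e.1) \in l & (0, e.2) \in l]] in
  if fuel is fuel'.+1 then
    if cands is q :: _ then
      if flip_list m l q is Some l' then q :: fan_flips fuel' m l' else [::]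
    else [::]
  else [::].

(** Since a quadruple undoes its own flip, the reversed list for [q] leads from the fan back to
    [q]. *)
Definition via_fan (m : nat) (p q : rel nat) :=
  let flips_of r := fan_flips m m [seq e <- pairs m | r e.1 e.2] in
  flips_of p ++ rev (flips_of q).

Lemma size_fan_flips k m l : size (fan_flips k m l) <= k.
Proof.
elim: k l => [|k IH] l //=.
by case: flatten => // q _; case: flip_list => //= l'; rewrite ltnS.
Qed.

Lemma size_via_fan m p q : size (via_fan m p q) <= m.*2.
Proof. by rewrite size_cat size_rev -addnn leq_add ?size_fan_flips. Qed.

(** * The moving front *)

(** The sums [n + 1] and [n + 2] are the edges [L_(k+1) R_k] and [L_(k+2) R_k]. The second disjunct
    is the irregular end at [R_1]: the side to [0] and the edge to [1]. *)
Definition minus_rel (n : nat) : rel nat := fun x y =>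
  [|| y == x.+1, (y == n.-1) && (x <= 1), x + y == n.+1 | x + y == n.+2].

(** The sums [n - 4] and [n - 3] are the edges [L_(k-4) R_k] and [L_(k-3) R_k]; here the irregular
    end is at vertex [0]. *)
Definition plus_rel (n : nat) : rel nat := fun x y =>
  [|| y == x.+1, (x == 0) && ((y == n.-1) || (y == n.-2)), (x + y).+4 == n
    | (x + y).+3 == n].

(* The second and third disjuncts are the part of [D_n^+] behind a front at position
   [b], the last one is the part of [D_n^-] ahead of it, and the three in between are
   the interface: a fan at [R_5], a fan at [R_8] and the edge [L_7 L_9]. *)
Definition front_rel (n b : nat) : rel nat := fun x y =>
  [|| y == x.+1,
      (x == 0) && ((y == n.-1) || (y == n.-2)),
      (x <= b.+1) && (((x + y).+4 == n) || ((x + y).+3 == n)),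
      (y + b + 5 == n) &&
        [|| b + 2 <= x <= b + 4, x + b + 8 == n | x + b + 7 == n],
      (y + b + 8 == n) && (b + 4 <= x <= b + 7),
      (x == b + 7) && (y == b + 9)
    | [&& b + 9 <= x, y + b + 8 <= n & (x + y == n.+1) || (x + y == n.+2)]].

Ltac split_hyps :=
  repeat match goal with
  | H : is_true (_ || _) |- _ => case/orP: H => H
  | H : is_true (_ && _) |- _ => let H' := fresh in case/andP: H => H H'
  end.

Ltac solve_disj :=
  lazymatch goal with
  | |- is_true (_ || _) =>
      solve [apply/orP; left; solve_disj | apply/orP; right; solve_disj]
  | |- is_true (_ && _) => apply/andP; split; solve_disj
  | |- _ => lia
  end.

(** Each disjunct of one relation either contradicts the side conditions or implies one disjunct of
    the other by linear arithmetic. *)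
Ltac solve_rel_eq :=
  rewrite /front_rel /plus_rel /minus_rel;
  let H := fresh in apply/idP/idP => H; split_hyps; first [exfalso; lia | solve_disj].

(** A missing pair [x < y] is crossed by a zigzag edge ending at [y - 1] or [y + 1], whose other end
    is fixed by the sum [n + 1] or [n + 2]; the exception [{0, 2}] is crossed by [{1, n - 1}]. The
    relations reached later inherit maximality along the flips. *)
Lemma max_noncrossing_minus n : 3 <= n -> max_noncrossing n (minus_rel n).
Proof.
move=> n3; split=> [x y u v xy yn uv vn Pxy Puv|x y xy yn H].
  by move/or4P: Pxy => [] Pxy; move/or4P: Puv => [] Puv; rewrite /cross; lia.
apply/negP => /negP; rewrite !negb_or => /and4P[N1 N2 N3 N4].
have bad u v : u < v -> v < n -> (u + v == n.+1) || (u + v == n.+2) -> ~~ cross x y u v.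
  by move=> uv vn h; apply: H => //; rewrite /minus_rel h !orbT.
have bad1 : ~~ cross x y 1 n.-1.
  by case: (ltngtP n 3) n3 => // h _; [apply: H; rewrite /minus_rel ?eqxx|rewrite /cross; lia]; lia.
case: (leqP (x + y) n) => xyn; last by have := bad (n.+2 - y) y.-1; rewrite /cross; lia.
case: (leqP (y + y) n.+1) => yy; last by have := bad (n.+1 - y) y.+1; rewrite /cross; lia.
case: (leqP y 2) => y2; first by move: bad1; rewrite /cross; lia.
by have := bad y.-1 (n.+2 - y); rewrite /cross; lia.
Qed.

(* Found by a computer search over intermediate periodic triangulations. The first
   18 flips stay ahead of the edge [L_9 R_8], the last 13 behind [L_9 R_13]. Vertex
   [i] stands for vertex [i + 1] of the 34-gon. *)
Definition front_flips : seq (nat * nat * nat * nat) :=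
  [:: (9, 10, 23, 24); (9, 23, 24, 25); (8, 9, 23, 25); (12, 13, 20, 21);
      (12, 20, 21, 22); (11, 12, 20, 22); (14, 15, 18, 19); (14, 15, 16, 18);
      (14, 16, 17, 18); (14, 18, 19, 20); (14, 17, 18, 20); (13, 14, 17, 20);
      (12, 13, 17, 20); (11, 12, 17, 20); (11, 20, 22, 23); (10, 11, 20, 23);
      (9, 10, 20, 23); (8, 9, 20, 23); (6, 8, 23, 25); (5, 6, 23, 25);
      (5, 23, 24, 25); (4, 5, 24, 25); (3, 25, 26, 28); (2, 3, 26, 28);
      (2, 26, 27, 28); (1, 2, 27, 28); (8, 20, 22, 23); (6, 8, 22, 23);
      (6, 7, 8, 22); (8, 20, 21, 22); (7, 8, 21, 22)].

(* Gluing the two blocks of a window turns [front_rel n b] into the same relation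
   on a smaller polygon; hence only finitely many cases have to be computed. *)
Lemma check_front : check_flips (17 + 12)
  (fun i k => front_rel 34 0 i.+1 k.+1) (fun i k => front_rel 34 8 i.+1 k.+1)
  front_flips.
Proof. by vm_compute. Qed.

(** [D_n^-] and the front at position [0] differ only within [L_0, ..., L_9] and [R_8, ..., R_1];
    glued together, these blocks form an 18-gon. *)
Lemma check_start : check_flips 18 (minus_rel 18) (front_rel 18 0)
   (via_fan 18 (minus_rel 18) (front_rel 18 0)).
Proof. by vm_compute. Qed.

(** Here [r] is the number of vertices left once twice the front position is subtracted. As the
    front advances by 8, the final [r] can be any of [18, ..., 33]. The window runs from [L_1] to
    [R_5], hence the shift by one and the [r - 5] vertices. *)
Lemma check_end : all (fun r => let p i k := front_rel r 0 i.+1 k.+1 in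
   let q i k := plus_rel r i.+1 k.+1 in
   check_flips (r - 5) p q (via_fan (r - 5) p q)) (iota 18 16).
Proof. by vm_compute. Qed.

Lemma check_small : all (fun n => check_flips n (minus_rel n) (plus_rel n)
   (via_fan n (minus_rel n) (plus_rel n))) (iota 3 15).
Proof. by vm_compute. Qed.

Lemma flips_start n : 18 <= n -> exists2 k, k <= 36 &
  flips (polygon n) k (edges_of n (minus_rel n)) (edges_of n (front_rel n 0)) /\
  max_noncrossing n (front_rel n 0).
Proof.
move=> n18; exists (size (via_fan 18 (minus_rel 18) (front_rel 18 0))).
  exact: size_via_fan.
apply: (flips_window (s := 0) (a := 10) (t := n - 8) (b := 8) _ _ _ _ _ check_start);
  rewrite ?add0n; try lia.
- by move=> x y xy yn out; solve_rel_eq.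
- by move=> i k ik km; rewrite /window; case: ifP => ?; case: ifP => ?; solve_rel_eq.
- by move=> i k ik km; rewrite /window; case: ifP => ?; case: ifP => ?; solve_rel_eq.
- by apply: max_noncrossing_minus; lia.
Qed.

Lemma flips_front n b : b.*2 + 34 <= n -> max_noncrossing n (front_rel n b) ->
  flips (polygon n) 31 (edges_of n (front_rel n b)) (edges_of n (front_rel n (b + 8))) /\
  max_noncrossing n (front_rel n (b + 8)).
Proof.
move=> hn.
(* The blocks are [L_(b+1), ..., L_(b+17)] and [R_(b+16), ..., R_(b+5)]: from the last edge behind
   the old front to the first edge ahead of the new one. They are disjoint exactly when
   [2b + 34 <= n]. *)
apply: (flips_window (s := b.+1) (a := 17) (t := n - 16 - b) (b := 12) _ _ _ _ _ check_front);
  try lia.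
- by move=> x y xy yn out; solve_rel_eq.
- by move=> i k ik km; rewrite /window; case: ifP => ?; case: ifP => ?; solve_rel_eq.
- by move=> i k ik km; rewrite /window; case: ifP => ?; case: ifP => ?; solve_rel_eq.
Qed.

Lemma flips_end n b : b.*2 + 18 <= n < b.*2 + 34 -> max_noncrossing n (front_rel n b) ->
  exists2 k, k <= 56 &
  flips (polygon n) k (edges_of n (front_rel n b)) (edges_of n (plus_rel n)).
Proof.
move=> hn mnc; pose r := n - b.*2; have Er : r = n - b.*2 by [].
have rI : r \in iota 18 16 by rewrite mem_iota; lia.
pose p i k := front_rel r 0 i.+1 k.+1; pose q i k := plus_rel r i.+1 k.+1.
have : check_flips (r - 5) p q (via_fan (r - 5) p q) := allP check_end _ rI.
(* The window is a single block, so the second block is taken empty. As [r - 5 <= 28], passing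
   through the fan costs at most 56 flips. *)
rewrite -[r - 5]addn0 => chk; exists (size (via_fan (r - 5 + 0) p q)).
  by apply: leq_trans (size_via_fan _ _ _) _; lia.
apply: (proj1 (flips_window (s := b.+1) (t := n) _ _ _ _ _ chk mnc)); try lia.
- by move=> x y xy yn out; solve_rel_eq.
- by move=> i k ik km; rewrite /window /p; case: ifP => ?; case: ifP => ?; solve_rel_eq.
- by move=> i k ik km; rewrite /window /q; case: ifP => ?; case: ifP => ?; solve_rel_eq.
Qed.

(** Each advance costs 31 flips and uses up 16 vertices, and the two ends cost at most [36 + 56]
    flips together; [1600] leaves slack. *)
Lemma flips_minus_plus n : 3 <= n -> exists2 k, 16 * k <= 31 * n + 1600 &
  flips (polygon n) k (edges_of n (minus_rel n)) (edges_of n (plus_rel n)).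
Proof.
move=> n3; case: (ltnP n 18) => n18.
  have nI : n \in iota 3 15 by rewrite mem_iota; lia.
  have := allP check_small _ nI; rewrite -{1 4}[n]addn0 => chk.
  exists (size (via_fan (n + 0) (minus_rel n) (plus_rel n))).
    have := size_via_fan (n + 0) (minus_rel n) (plus_rel n); lia.
  apply: (proj1 (flips_window (s := 0) (t := n) _ _ _ _ _ chk (max_noncrossing_minus n3)));
    try lia;
  by move=> i k ik km; rewrite /window; case: ifP => ?; case: ifP => ? //; lia.
have iter j : 16 * j + 18 <= n -> exists k, [/\ k <= 31 * j + 36,
    flips (polygon n) k (edges_of n (minus_rel n)) (edges_of n (front_rel n (8 * j))) &
    max_noncrossing n (front_rel n (8 * j))].
  elim: j => [|j IH] hj.
    by have [k kle [F M]] := flips_start n18; exists k.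
  have [|k [kle F M]] := IH; first by lia.
  have [|F' M'] := @flips_front n (8 * j) _ M; first by lia.
  exists (k + 31); rewrite (_ : 8 * j.+1 = 8 * j + 8); last by lia.
  by split=> //; [lia|apply: flips_cat F F'].
(* This is the largest number of advances with [16 j + 18 <= n], so that between 18 and 33 vertices
   remain for the end. *)
have [|k [kle F M]] := iter ((n - 18) %/ 16); first by lia.
have [|l lle F'] := @flips_end n (8 * ((n - 18) %/ 16)) _ M; first by lia.
by exists (k + l); [lia|apply: flips_cat F F'].
Qed.

(** * The pair [D n] *)

Lemma imfset_fset2 (T U : choiceType) (f : T -> U) (x y : T) :
  [fset f z | z in [fset x; y]] = [fset f x; f y].
Proof.
apply/fsetP => u; rewrite in_fset2; apply/imfsetP/orP => /=.
  by case=> z; rewrite in_fset2 => /orP[] /eqP -> ->; rewrite eqxx; auto.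
by case=> /eqP ->; [exists x|exists y]; rewrite // in_fset2 eqxx ?orbT.
Qed.

Lemma in_deletion (T : choiceType) (p : seq T) (a : T) S e :
  e \in deletion p a S <->
  exists e0, [/\ e0 \in S, e0 <> [fset a; next p a] &
    e = [fset (if x == a then next p a else x) | x in (e0 : {fset T})]].
Proof.
split=> [/imfsetP[e0 /=]|[e0 [e0S ne ->]]].
  by rewrite !inE => /andP[/eqP ne e0S] ->; exists e0.
by apply/imfsetP; exists e0; rewrite //= !inE e0S andbT; apply/eqP.
Qed.

Lemma in_relabel (T : choiceType) (p : seq T) v c S e :
  e \in relabel p v c S <->
  exists2 e0, e0 \in S & e = [fset label p v c x | x in (e0 : {fset T})].
Proof.
by split=> [/imfsetP[e0 /=]|[e0 e0S ->]]; [exists e0|apply/imfsetP; exists e0].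
Qed.

(* The edges [{2-k, 4+k}] have vertex sum 6 and the edges [{1-k, 4+k}] sum 5 modulo [N];
   all other pairs with these sums are sides. The last two disjuncts matter for [N = 4]. *)
Definition zigzag_rel (N : nat) : rel nat := fun x y =>
  [|| y == x.+1, (x == 0) && (y == N.-1), x + y == 5, x + y == 6,
      x + y == N + 5, x + y == N + 6, x + y + N == 5 | x + y + N == 6].

Lemma zigzag_edges_of N : 4 <= N -> zigzag N = edges_of N (zigzag_rel N).
Proof.
move=> N4.
(* For [c = 1] or [c = 2], the end [c - k] stays nonnegative when [k <= c], giving sum 5 or 6;
   otherwise it becomes [N + c - k] and the sum grows by [N]. *)
have mod_wrap c k : c < N -> k <= c -> (N + c - k) %% N = c - k.
  by move=> cN kc; rewrite -addnBA // modnDl modn_small; lia.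
have mod_low c k : c < k -> k < N -> (N + c - k) %% N = N + c - k.
  by move=> ck kN; rewrite modn_small; lia.
have oddE k : (k.*2.+1).-1./2 = k by rewrite /= doubleK.
have evenE k : (k.*2.+2).-1./2 = k by rewrite /= uphalf_double.
have edgeE k : (4 + k < N -> zigzag_edge N k.*2.+1 = [fset (N + 2 - k) %% N; 4 + k]) /\
               (4 + k < N -> zigzag_edge N k.*2.+2 = [fset (N + 1 - k) %% N; 4 + k]).
  by split=> kN; rewrite /zigzag_edge ?oddE ?evenE /= odd_double /= (modn_small kN).
apply/fsetP => e; rewrite in_fsetU boundary_polygon; last by lia.
apply/orP/idP.
  case=> [/in_edges_of[x [y [xy yn h ->]]]|/imfsetP[i /=]].
    by rewrite fset2_in_edges_of // /zigzag_rel orbA h.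
  rewrite mem_iota => iN ->.
  (* Only for [N = 4] does the end [4 + k] wrap around, to vertex [0]. *)
  case: (N =P 4) => [N4'|/eqP N4'].
    have -> : i = 1 by lia.
    rewrite N4'; have -> : zigzag_edge 4 1 = [fset 0; 2] by rewrite fsetUC.
    by rewrite fset2_in_edges_of.
  have [k [Ei kN]] : exists k, (i = k.*2.+1 \/ i = k.*2.+2) /\ 4 + k < N.
    by exists i.-1./2; lia.
  have [Eo Ee] := edgeE k.
  have mem x y : x < y -> y < N -> zigzag_rel N x y ->
      [fset x; y] \in edges_of N (zigzag_rel N).
    by move=> xy yN; rewrite fset2_in_edges_of.
  case: Ei => Ei; rewrite Ei ?Eo ?Ee //.
    case: (leqP k 2) => k2.
      by rewrite mod_wrap; try lia; apply: mem; try lia; rewrite /zigzag_rel; solve_disj.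
    by rewrite mod_low; try lia; rewrite fsetUC; apply: mem; try lia; rewrite /zigzag_rel; solve_disj.
  case: (leqP k 1) => k1.
    by rewrite mod_wrap; try lia; apply: mem; try lia; rewrite /zigzag_rel; solve_disj.
  by rewrite mod_low; try lia; rewrite fsetUC; apply: mem; try lia; rewrite /zigzag_rel; solve_disj.
case/in_edges_of => x [y [xy yN h ->]].
case: (boolP ((y == x.+1) || (x == 0) && (y == N.-1))) => [bd|inn].
  by left; rewrite fset2_in_edges_of.
right; apply/imfsetP => /=.
case: (N =P 4) => [N4'|/eqP N4'].
  exists 1; first by rewrite N4'.
  have [-> ->] : x = 0 /\ y = 2 by move: h inn; rewrite /zigzag_rel; lia.
  by rewrite N4' fsetUC.
have {}h : [|| x + y == 5, x + y == 6, x + y == N + 5 | x + y == N + 6].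
  by move: h inn; rewrite /zigzag_rel; lia.
(* For sums 5 and 6 the smaller end is [1 - k] or [2 - k]; for the sums shifted by [N] it is
   [4 + k]. Solving for [k] gives the index. *)
case/or4P: h => /eqP h.
- exists (1 - x).*2.+2; first by rewrite mem_iota; lia.
  have kN : 4 + (1 - x) < N by lia.
  rewrite (proj2 (edgeE _) kN).
  by rewrite mod_wrap; try lia; congr [fset _; _]; lia.
- exists (2 - x).*2.+1; first by rewrite mem_iota; lia.
  have kN : 4 + (2 - x) < N by lia.
  rewrite (proj1 (edgeE _) kN).
  by rewrite mod_wrap; try lia; congr [fset _; _]; lia.
- exists (x - 4).*2.+2; first by rewrite mem_iota; lia.
  have kN : 4 + (x - 4) < N by lia.
  rewrite (proj2 (edgeE _) kN).
  by rewrite mod_low; try lia; rewrite fsetUC; congr [fset _; _]; lia.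
- exists (x - 4).*2.+1; first by rewrite mem_iota; lia.
  have kN : 4 + (x - 4) < N by lia.
  rewrite (proj1 (edgeE _) kN).
  by rewrite mod_low; try lia; rewrite fsetUC; congr [fset _; _]; lia.
Qed.

Lemma index_iota_shift m n x : m <= x < m + n -> index x (iota m n) = x - m.
Proof.
move=> /andP[mx xn]; have xmn : x - m < n by lia.
by rewrite -{1}(subnKC mx) -(nth_iota 0 m xmn) index_uniq ?size_iota ?iota_uniq.
Qed.

Lemma in_relabel_deletion N P (p q : seq nat) a v c e :
  e \in relabel q v c (deletion p a (edges_of N P)) <->
  exists x y, [/\ x < y, y < N, P x y, [fset x; y] <> [fset a; next p a] &
    let g z := label q v c (if z == a then next p a else z) in e = [fset g x; g y]].
Proof.
split=> [/in_relabel[e1 /in_deletion[e0 [/in_edges_of[x [y [xy yN Pxy E0]]] ne ->]] ->]|].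
  by exists x, y; split=> //; rewrite -?E0 // E0 !imfset_fset2.
case=> x [y [xy yN Pxy ne /= ->]]; apply/in_relabel.
exists [fset (if z == a then next p a else z) | z in [fset x; y]]; last by rewrite !imfset_fset2.
by apply/in_deletion; exists [fset x; y]; rewrite fset2_in_edges_of.
Qed.

Lemma in_relabel_deletion2 N P (p q : seq nat) a b v c r e :
  e \in relabel r v c (deletion q b (deletion p a (edges_of N P))) <->
  exists x y, let f z := if z == a then next p a else z in
    [/\ x < y, y < N, P x y,
      [fset x; y] <> [fset a; next p a] /\ [fset f x; f y] <> [fset b; next q b] &
    let g z := label r v c (if f z == b then next q b else f z) in e = [fset g x; g y]].
Proof.
split.
  case/in_relabel => e2 /in_deletion[e1 [/in_deletion[e0 [e0S ne E1]] ne1 ->]] ->.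
  have /in_edges_of[x [y [xy yN Pxy E0]]] := e0S.
  exists x, y; split=> //; last by rewrite E1 E0 !imfset_fset2.
  by split; [rewrite -E0|move: ne1; rewrite E1 E0 imfset_fset2].
case=> x [y [xy yN Pxy [ne ne1] /= ->]]; apply/in_relabel.
set f := fun z => if z == a then next p a else z.
exists [fset (if z == b then next q b else z) | z in [fset f x; f y]]; last by rewrite !imfset_fset2.
apply/in_deletion; exists [fset f x; f y]; split=> //.
by apply/in_deletion; exists [fset x; y]; rewrite fset2_in_edges_of // imfset_fset2.
Qed.

(** The two deletions merge [0], [1], [2] into one vertex labelled [n - 1], and every [z >= 3]
    becomes [z - 3]. The sums [N + 5] and [N + 6] with [N = n + 2] thus turn into [n + 1] and
    [n + 2], and the edges at the merged vertices form the irregular end. *)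
Lemma Dminus_edges_of n : 3 <= n -> Dminus n = edges_of n (minus_rel n).
Proof.
case: n => // n n3; rewrite /Dminus zigzag_edges_of; last by lia.
rewrite addn2.
have -> : rem 0 (polygon n.+3) = iota 1 n.+2 by [].
have -> : rem 1 (iota 1 n.+2) = iota 2 n.+1 by [].
have next0 : next (polygon n.+3) 0 = 1 by [].
have next1 : next (iota 1 n.+2) 1 = 2 by [].
have gE z : z < n.+3 ->
    label (iota 2 n.+1) 2 (n.+1 - 1)
      (if (if z == 0 then 1 else z) == 1 then 2 else if z == 0 then 1 else z) =
    if z <= 2 then n else z - 3.
  move=> zn; rewrite /label size_iota.
  set w := (if _ == 1 then _ else _).
  have Ew : w = maxn z 2 by rewrite /w; case: z zn @w => [|[|z]] //= _; lia.
  rewrite !index_iota_shift; try lia.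
  case: (leqP z 2) => z2.
    by rewrite (_ : _ + _ = n + n.+1); [rewrite modnDr modn_small|lia].
  by rewrite (_ : _ + _ = z - 3 + n.+1 + n.+1); [rewrite !modnDr modn_small; lia|lia].
apply/fsetP => e; apply/idP/idP.
  case/in_relabel_deletion2 => x [y]; rewrite next0 next1; cbv beta zeta => -[xy yn zz [ne1 ne2]].
  rewrite !gE; try lia.
  (* Edges inside [{0, 1, 2}] are the ones removed: [{0, 1}] by the first deletion, [{0, 2}] and
     [{1, 2}] by the second, where both read [{1, 2}]. *)
  have y2 : 2 < y.
    rewrite ltnNge; apply/negP => y2.
    have [] : [\/ x = 0 /\ y = 1, x = 0 /\ y = 2 | x = 1 /\ y = 2].
      by case: x y xy y2 {yn zz ne1 ne2} => [|[|x]] [|[|[|y]]] //= *; try lia; constructor.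
    - by case=> Ex Ey; case: ne1; rewrite Ex Ey.
    - by case=> Ex Ey; case: ne2; rewrite Ex Ey.
    - by case=> Ex Ey; case: ne2; rewrite Ex Ey.
  rewrite (leqNgt y 2) y2 /=; case: (leqP x 2) => x2 ->.
    rewrite fsetUC fset2_in_edges_of; try lia.
    have x3 : x = 0 \/ x = 1 \/ x = 2 by lia.
    by move: zz; case: x3 => [->|[->|->]]; rewrite /zigzag_rel /minus_rel => zz;
      split_hyps; try (exfalso; lia); solve_disj.
  rewrite fset2_in_edges_of; try lia.
  by move: zz; rewrite /zigzag_rel /minus_rel => zz;
      split_hyps; try (exfalso; lia); solve_disj.
case/in_edges_of => u [v [uv vn h ->]]; apply/in_relabel_deletion2; rewrite next0 next1; cbv beta zeta.
suff [x [y [xy yn y2 zz E]]] : exists x y, [/\ x < y, y < n.+3, 2 < y, zigzag_rel n.+3 x y &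
    [fset u; v] = [fset (if x <= 2 then n else x - 3); y - 3]].
  exists x, y; split=> //; last by rewrite E !gE ?(leqNgt y 2) ?y2 //; lia.
  split=> /eq_fset2; first by lia.
  by rewrite (_ : y == 0 = false); [case: ifP|]; lia.
case: (ltnP v n) => vn'.
  exists u.+3, v.+3; split; try lia; last by rewrite /= !subSS !subn0.
  by move: h; rewrite /zigzag_rel /minus_rel => h; split_hyps; try (exfalso; lia); solve_disj.
have Ev : v = n by lia.
(* The last label comes from all of [0], [1], [2]; which of them is joined to [u + 3] depends on
   [u]. *)
have [x [x2 zz]] : exists x, x <= 2 /\ zigzag_rel n.+3 x u.+3.
  case: (leqP u 1) => u1.
    by exists 2; rewrite /zigzag_rel; split=> //; have [->|->] : u = 0 \/ u = 1 by lia.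
  move: h; rewrite /minus_rel => h.
  have [Eu|[Eu|Eu]] : u = n.-1 \/ u = 2 \/ u = 3 by lia.
  - by exists 0; rewrite /zigzag_rel; split=> //; solve_disj.
  - by exists 1; rewrite /zigzag_rel Eu.
  - by exists 0; rewrite /zigzag_rel Eu /= orbT.
exists x, u.+3; split=> //; try lia.
by rewrite x2 Ev fsetUC /= !subSS subn0.
Qed.

(** Vertex [4] merges with its successor. For [n >= 4] the labels [0, 1, ...] start at the merged
    vertex, and [0, ..., 3] become [n - 4, ..., n - 1]. For [n = 3] the result is a triangle, all of
    whose pairs are sides. *)
Lemma Dplus_edges_of n : 3 <= n -> Dplus n = edges_of n (plus_rel n).
Proof.
move=> n3; rewrite /Dplus zigzag_edges_of; last by lia.
rewrite addn1.
case: (n =P 3) => [->|/eqP n_neq3].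
  have -> : 4 %% 4 = 0 by [].
  have -> : rem 0 (polygon 4) = [:: 1; 2; 3] by [].
  have -> : 3 - 2 = 1 by [].
  have next0 : next (polygon 4) 0 = 1 by [].
  have gE z : z < 4 -> label [:: 1; 2; 3] 2 1 (if z == 0 then 1 else z) = z.-1.
    by case: z => [|[|[|[|z]]]].
  apply/fsetP => e; apply/idP/idP.
    case/in_relabel_deletion => x [y]; rewrite next0 => -[xy y4 _ ne]; cbv beta zeta.
    rewrite !gE //; last by lia.
    have xy' : x.-1 < y.-1.
      by case: x y xy ne {y4} => [|x] [|[|y]].
    move=> ->; rewrite fset2_in_edges_of //; last by lia.
    by rewrite /plus_rel; lia.
  case/in_edges_of => u [v [uv v3 _ ->]]; apply/in_relabel_deletion; rewrite next0.
  have [x [y [xy y4 y1 zz [Eu Ev]]]] : exists x y,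
      [/\ x < y, y < 4, 1 < y, zigzag_rel 4 x y & x.-1 = u /\ y.-1 = v].
    case: u v uv v3 => [|[|[|u]]] [|[|[|v]]] //= _ _.
    - by exists 1, 2.
    - by exists 0, 3.
    - by exists 2, 3.
  exists x, y; split=> //; last by cbv beta zeta; rewrite !gE ?Eu ?Ev //; lia.
  by move/fset2_ordered => /(_ xy isT); lia.
case: n n3 n_neq3 => [|[|[|[|n]]]] // _ _.
have -> : 4 %% n.+4.+1 = 4 by rewrite modn_small.
have -> : rem 4 (polygon n.+4.+1) = [:: 0, 1, 2, 3 & iota 5 n] by [].
have next4 : next (polygon n.+4.+1) 4 = if n == 0 then 0 else 5 by case: n.
(* Truncation makes [4 - 5] equal to [0], the label of the successor of [4]. That successor is [5],
   or [0] in the pentagon, where [n] is now [0]. *)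
have gE z : z < n.+4.+1 ->
    label [:: 0, 1, 2, 3 & iota 5 n] 2 (n.+4 - 2)
      (if z == 4 then if n == 0 then 0 else 5 else z) =
    if z <= 3 then n + z else z - 5.
  move=> zn; rewrite /label.
  have -> : size [:: 0, 1, 2, 3 & iota 5 n] = n.+4 by rewrite /= size_iota.
  have -> : index 2 [:: 0, 1, 2, 3 & iota 5 n] = 2 by [].
  have [z3|z4] := leqP z 3.
    have -> : (if z == 4 then if n == 0 then 0 else 5 else z) = z by case: eqP; lia.
    have -> : index z [:: 0, 1, 2, 3 & iota 5 n] = z by case: z z3 {zn} => [|[|[|[|z]]]].
    by rewrite (_ : _ + _ = n + z + n.+4); [rewrite modnDr modn_small; lia|lia].
  have [n0|n0] := posnP n.
    have Ez : z = 4 by lia.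
    by rewrite Ez n0.
  set w := (if _ == 4 then _ else _).
  have Ew : w = maxn z 5 by rewrite /w; case: eqP; lia.
  have -> : index w [:: 0, 1, 2, 3 & iota 5 n] = w.-1.
    rewrite Ew /=; do 4 (case: eqP => [?|_]; first by lia).
    by rewrite index_iota_shift; lia.
  by rewrite (_ : _ + _ = z - 5 + n.+4 + n.+4); [rewrite !modnDr modn_small; lia|lia].
apply/fsetP => e; apply/idP/idP.
  case/in_relabel_deletion => x [y]; rewrite next4; cbv beta zeta => -[xy yn zz ne].
  rewrite !gE; try lia.
  have {}ne : ~~ ((x == 4) && (y == 5)) && ~~ [&& n == 0, x == 0 & y == 4].
    apply/andP; split; apply/negP.
      move=> /andP[/eqP Ex /eqP Ey]; apply: ne; rewrite Ex Ey.
      by case: eqP => //; lia.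
    move=> /and3P[/eqP n0 /eqP Ex /eqP Ey]; apply: ne; rewrite n0 Ex Ey /=.
    by rewrite fsetUC.
  suff [u [v [uv vn h]]] : exists u v, [/\ u < v, v < n.+4, plus_rel n.+4 u v &
      [fset (if x <= 3 then n + x else x - 5); (if y <= 3 then n + y else y - 5)] = [fset u; v]].
    by move=> -> ->; rewrite fset2_in_edges_of.
  have [x3|x4] := leqP x 3; have [y3|y4] := leqP y 3; try lia.
  - exists (n + x), (n + y); split=> //; try lia.
    by move: zz; rewrite /zigzag_rel /plus_rel => zz; split_hyps; try (exfalso; lia); solve_disj.
  - exists (y - 5), (n + x); rewrite fsetUC; split=> //; try lia.
    have x0123 : [\/ x = 0, x = 1, x = 2 | x = 3].
      by case: x x3 {xy zz ne} => [|[|[|[|x]]]] // _; constructor.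
    by move: zz ne; case: x0123 => ->; rewrite /zigzag_rel /plus_rel => zz ne;
      split_hyps; try (exfalso; lia); solve_disj.
  - exists (x - 5), (y - 5).
    have x5 : 5 <= x by move: zz; rewrite /zigzag_rel => zz; split_hyps; lia.
    split=> //; try lia.
    by move: zz; rewrite /zigzag_rel /plus_rel => zz; split_hyps; try (exfalso; lia); solve_disj.
case/in_edges_of => u [v [uv vn h ->]]; apply/in_relabel_deletion; rewrite next4; cbv beta zeta.
suff [x [y [xy yn ne zz E]]] : exists x y, [/\ x < y, y < n.+4.+1,
    ~~ ((x == 4) && (y == 5)) && ~~ [&& n == 0, x == 0 & y == 4], zigzag_rel n.+4.+1 x y &
    [fset u; v] = [fset (if x <= 3 then n + x else x - 5); (if y <= 3 then n + y else y - 5)]].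
  exists x, y; split=> //; last by rewrite E !gE //; lia.
  by move/eq_fset2; case: (n =P 0) => n0; lia.
(* Label [0] is shared by [4] and its successor, so the preimage must be chosen according to [v]. *)
have [u0|u0] := posnP u.
  have [v1|v1] := leqP v n.-1.
    have Ev : v = 1 by move: h; rewrite /plus_rel => h; split_hyps; lia.
    exists 5, 6; rewrite /zigzag_rel eqxx u0 Ev; split=> //; lia.
  have [Ev|Ev] : v = n \/ n < v by lia.
    by exists 0, 5; rewrite /zigzag_rel /= !orbT u0 Ev addn0 fsetUC; split=> //; lia.
  exists (v - n), 4; rewrite fsetUC u0; split; try lia.
    by move: h; rewrite /zigzag_rel /plus_rel => h; split_hyps; try (exfalso; lia); solve_disj.
  by congr [fset _; _]; case: ifP; lia.
have [vn'|vn'] := ltnP v n.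
  exists (u + 5), (v + 5); split; try lia.
    by move: h; rewrite /zigzag_rel /plus_rel => h; split_hyps; try (exfalso; lia); solve_disj.
  by congr [fset _; _]; case: ifP; lia.
have [un|un] := leqP n u.
  exists (u - n), (v - n); split; try lia.
    by move: h; rewrite /zigzag_rel /plus_rel => h; split_hyps; try (exfalso; lia); solve_disj.
  by congr [fset _; _]; case: ifP; lia.
exists (v - n), (u + 5); rewrite fsetUC; split; try lia.
  by move: h; rewrite /zigzag_rel /plus_rel => h; split_hyps; try (exfalso; lia); solve_disj.
by congr [fset _; _]; case: ifP; lia.
Qed.

(** * The flip distance and the final bound *)

(** By excluded middle either a shorter flip sequence exists, and strong induction applies, or [k]
    itself is the minimum. *)
Lemma is_delta_le (T : choiceType) (p : seq T) P k :
  flips p k P.1 P.2 -> exists2 d, is_delta p P d & d <= k.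
Proof.
elim/ltn_ind: k => k IH Fk.
have [[l [lk Fl]]|nol] := classic (exists l, l < k /\ flips p l P.1 P.2).
  by have [d dP dl] := IH l lk Fl; exists d => //; lia.
exists k => //; split=> // l Fl; rewrite leqNgt; apply/negP => lk.
by apply: nol; exists l.
Qed.

Import Order.TTheory GRing.Theory Num.Theory.

Theorem theorem14 :
  exists K : rat, forall n : nat, 3 <= n ->
    exists d : nat, is_delta (polygon n) (D n) d /\
      (d%:R <= 31%:R / 16%:R * n%:R + K :> rat)%R.
Proof.
(* The constant is [1600 / 16]. *)
exists 100%:R%R => n n3.
have [k kle Fk] := flips_minus_plus n3.
have [|d dP dk] := @is_delta_le _ (polygon n) (D n) k.
  by rewrite /D /= Dminus_edges_of // Dplus_edges_of.
exists d; split=> //.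
have : ((16 * d)%:R <= (31 * n + 1600)%:R :> rat)%R by rewrite ler_nat; lia.
by rewrite natrD !natrM; lra.
Qed.
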